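(* Let $T\ge 1$ and for $t=1,\ldots,T$ let $f_t\colon\mathbb{R}^n\to\mathbb{R}$ be differentiable, with minimizer $\bm{w}_t^\star\in\arg\min_{\bm{w}\in\mathbb{R}^n}f_t(\bm{w})$. Let $\mathcal{W}_1,\ldots,\mathcal{W}_T\subset\mathbb{R}^n$ be closed convex sets such that $\mathcal{W}_t$ contains the set of minimizers of $f_t$. Suppose that, for all $t$, $f_t$ is $\rho$-quasar-convex with respect to $\bm{w}_t^\star$ (for a common $\rho\in(0,1]$) and $\mathcal{W}_t$ is bounded with $\mathrm{diam}(\mathcal{W}_t)\le R$. Let $(\bm{w}_t)$ be generated by online projected gradient descent (as described in the context) with initialization $\bm{w}_1\in\mathcal{W}_1$ and gradient error bounds $\delta_t$. Then: (i) If $f_t$ is $\Gamma$-weakly smooth for all $t=1,\ldots,T$ and the step size satisfies $0<\alpha_t=\alpha<\frac{2\rho}{\Gamma}$, then $$\mathrm{Regret}(T)\le \frac{1}{2\alpha\rho-\alpha^2\Gamma}\|\bm{w}_1-\bm{w}_1^\star\|^2+\frac{3R}{2\alpha\rho-\alpha^2\Gamma}\sum_{t=1}^{T-1}\|\bm{w}_t^\star-\bm{w}_{t+1}^\star\|+\frac{\alpha}{2\rho-\alpha\Gamma}\sum_{t=1}^{T-1}\delta_t^2 .$$ (ii) If the gradient of $f_t$ is bounded over $\mathcal{W}_t$ for all $t=1,\ldots,T$, i.e., $\|\nabla f_t(\bm{w})\|\le M$ for all $\bm{w}\in\mathcal{W}_t$, and the step size is $\alpha_t=\alpha=\frac{c}{\sqrt{T}}$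 for some constant $c>0$, then $$\mathrm{Regret}(T)\le\left(\frac{1}{2c\rho}\|\bm{w}_1-\bm{w}_1^\star\|^2+\frac{cM}{2\rho}\right)\sqrt{T}+\frac{3R}{2\rho c}\sqrt{T}\sum_{t=1}^{T-1}\|\bm{w}_t^\star-\bm{w}_{t+1}^\star\|+\frac{\alpha}{2\rho}\sum_{t=1}^{T-1}\delta_t^2 .$$
   Context: $\|\cdot\|$ is the Euclidean norm; $\mathrm{diam}(\mathcal{W})=\max_{\bm{w},\bm{w}'\in\mathcal{W}}\|\bm{w}-\bm{w}'\|$; $\mathrm{proj}_{\mathcal{W}}$ is the Euclidean projection onto $\mathcal{W}$. Quasar-convexity: for $\rho\in(0,1]$, a differentiable $f$ with minimizer $\bm{w}^\star$ is $\rho$-quasar-convex with respect to $\bm{w}^\star$ if $f(\bm{w}^\star)\ge f(\bm{w})+\frac{1}{\rho}\langle\nabla f(\bm{w}),\bm{w}^\star-\bm{w}\rangle$ for all $\bm{w}\in\mathbb{R}^n$. Weak smoothness: a differentiable $f$ is $\Gamma$-weakly smooth if $\|\nabla f(\bm{w})\|^2\le\Gamma(f(\bm{w})-f(\bm{w}^\star))$ for all $\bm{w}\in\mathbb{R}^n$, where $\bm{w}^\star$ is a minimizer of $f$ over $\mathbb{R}^n$. Online projected gradient descent: for $t=1,\ldots,T-1$, $\bm{w}_{t+1}=\mathrm{proj}_{\mathcal{W}_{t+1}}(\bm{w}_t-\alpha_t\tilde\nabla f_t(\bm{w}_t))$, where $\tilde\nabla f_t(\bm{w}_t)=\nabla f_t(\bm{w}_t)+\bm{e}_t$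 is a gradient estimate built from i.i.d. samples collected at time $t$, with random error $\bm{e}_t$ satisfying $\mathbb{E}[\bm{e}_t\mid\bm{w}_t]=\bm{0}$ and $\mathbb{E}[\|\bm{e}_t\|^2]\le\delta_t^2$ for a constant $\delta_t>0$. Dynamic regret: $\mathrm{Regret}(T)=\sum_{t=1}^T(\mathbb{E}[f_t(\bm{w}_t)]-f_t(\bm{w}_t^\star))$.
   Formalization: In (ii) the term cM/(2ρ) is corrected to cM²/(2ρ): the printed bound fails for n = T = ρ = 1, f(x) = 8x² on [-1,1], w_1 = 1, M = 16, c = 1/4 (regret 8, bound 4); for M ≤ 1 the corrected bound implies the printed one. *)

(* Defs.v *)
From HB Require Import structures.
From mathcomp Require Import all_boot all_order all_algebra.
From mathcomp Require Import all_classical all_reals all_analysis.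

Set Implicit Arguments.
Unset Strict Implicit.
Unset Printing Implicit Defensive.

Import Order.TTheory GRing.Theory Num.Theory.
Import numFieldNormedType.Exports.

Local Open Scope classical_set_scope.
Local Open Scope ring_scope.

Section Euclidean.
Context {R : realType} {n : nat}.
Implicit Types (u v w : 'rV[R]_n) (W : set 'rV[R]_n).

Definition dotp u v : R := \sum_(i < n) u 0 i * v 0 i.

(* The library norm `|u| on 'rV[R]_n is the max norm, not this one; both induce
   the topology and the bounded sets of 'rV[R]_n used below. *)
Definition enorm u : R := Num.sqrt (dotp u u).

(* [sup] is only meaningful for a nonempty bounded W; it is a maximum when W is
   moreover closed. *)
Definition diam W : R :=
  sup [set r | exists u v, [/\ W u, W v & r = enorm (u - v)]].

(* Arbitrary when no nearest point exists; the nearest point exists and is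
   unique when W is nonempty, closed and convex. *)
Definition proj W u : 'rV[R]_n :=
  get [set v | W v /\ forall v', W v' -> enorm (u - v) <= enorm (u - v')].

End Euclidean.

Section Functions.
Context {R : realType} {n : nat}.
Implicit Types (f : 'rV[R]_n -> R) (w ws : 'rV[R]_n).

Definition grad f w : 'rV[R]_n := \row_(i < n) 'D_(delta_mx 0 i) f w.

Definition argmin f : set 'rV[R]_n := [set ws | forall w, f ws <= f w].

Definition quasar_convex (rho : R) f ws : Prop :=
  forall w, f w + rho^-1 * dotp (grad f w) (ws - w) <= f ws.

Definition weakly_smooth (Gamma : R) f ws : Prop :=
  forall w, enorm (grad f w) ^+ 2 <= Gamma * (f w - f ws).

End Functions.

Section Probability.
Context {R : realType} {d : measure_display} {Omega : measurableType d}.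
Context {n : nat}.

Definition borel_rV : set (set 'rV[R]_n) := <<s open >>.

Definition random_vector (X : Omega -> 'rV[R]_n) : Prop :=
  forall B, borel_rV B -> measurable (X @^-1` B).

Definition sigma_rV (X : Omega -> 'rV[R]_n) : set (set Omega) :=
  preimage_set_system setT X borel_rV.

(* Y is a version of E[Z | X]. *)
Definition is_cond_expectation (P : probability Omega R)
    (Z : Omega -> R) (X : Omega -> 'rV[R]_n) (Y : Omega -> R) : Prop :=
  [/\ P.-integrable setT (EFin \o Z),
      P.-integrable setT (EFin \o Y),
      forall B, measurable B -> sigma_rV X (Y @^-1` B) &
      forall A, sigma_rV X A ->
        (\int[P]_(x in A) (Y x)%:E = \int[P]_(x in A) (Z x)%:E)%E].

(* E[e | X] = 0, coordinate by coordinate. *)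
Definition cond_mean_zero (P : probability Omega R)
    (e X : Omega -> 'rV[R]_n) : Prop :=
  forall i : 'I_n, is_cond_expectation P (fun x => e x 0 i) X (cst 0).

Definition online_pgd (T : nat) (f : nat -> 'rV[R]_n -> R)
    (W : nat -> set 'rV[R]_n) (alpha : nat -> R)
    (e : nat -> Omega -> 'rV[R]_n) (w1 : 'rV[R]_n)
    (w : nat -> Omega -> 'rV[R]_n) : Prop :=
  (forall x, w 1%N x = w1) /\
  (forall t, (1 <= t < T)%N -> forall x,
     w t.+1 x =
       proj (W t.+1) (w t x - alpha t *: (grad (f t) (w t x) + e t x))).

Definition gradient_error (T : nat) (P : probability Omega R)
    (delta : nat -> R) (w e : nat -> Omega -> 'rV[R]_n) : Prop :=
  forall t, (1 <= t < T)%N ->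
    [/\ 0 < delta t, random_vector (e t), cond_mean_zero P (e t) (w t) &
        ('E_P[fun x => (enorm (e t x) ^+ 2)%R] <= (delta t ^+ 2)%:E)%E].

Definition regret (T : nat) (P : probability Omega R)
    (f : nat -> 'rV[R]_n -> R) (w : nat -> Omega -> 'rV[R]_n)
    (wstar : nat -> 'rV[R]_n) : \bar R :=
  (\sum_(1 <= t < T.+1)
     ('E_P[fun x => f t (w t x)] - (f t (wstar t))%:E))%E.

End Probability.

(* Main.v *)
(* For kappa > 0, C such that on W_t
     -2 alpha <grad f_t(v), v - wstar_t> + alpha^2 |grad f_t(v)|^2
       <= - kappa (f_t(v) - f_t(wstar_t)) + C,
   one gradient step decreases the expected squared distance to wstar_t by
   kappa times the gap, up to C and the variance alpha^2 delta_t^2: the terms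
   linear in the error e_t are e_t times a bounded Borel function of w_t, hence
   have mean zero.  Projecting on W_{t+1} and moving the reference point from
   wstar_t to wstar_{t+1} costs at most 2 D |wstar_t - wstar_{t+1}|, and the sum over t
   telescopes.  The final term t = T involves no error: it follows from
   0 <= |w_T - wstar_T - alpha grad f_T(w_T)|^2.  Quasar-convexity gives the
   displayed inequality with kappa = 2 alpha rho - alpha^2 Gamma, C = 0 in (i)
   and with kappa = 2 alpha rho, C = alpha^2 M^2 in (ii). *)

Require Import Defs.
From HB Require Import structures.
From mathcomp Require Import all_boot all_order all_algebra.
From mathcomp Require Import all_classical all_reals all_analysis.
From mathcomp Require Import measurable_realfun ring lra.

Set Implicit Arguments.
Unset Strict Implicit.
Unset Printing Implicit Defensive.

Import Order.TTheory GRing.Theory Num.Theory.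
Import numFieldNormedType.Exports.

Local Open Scope classical_set_scope.
Local Open Scope ring_scope.

(* The library's [proj] (a coordinate of a product) shadows the Euclidean one. *)
Local Notation proj := Defs.proj.

(** * Euclidean geometry: Cauchy-Schwarz and projection onto compact convex sets *)

Section EuclideanGeometry.
Context {R : realType} {n : nat}.
Implicit Types (u v w p y a b : 'rV[R]_n) (W : set 'rV[R]_n).

Lemma dotpC u v : dotp u v = dotp v u.
Proof. by apply: eq_bigr => i _; rewrite mulrC. Qed.

Lemma dotpDl u v w : dotp (u + v) w = dotp u w + dotp v w.
Proof. by rewrite -big_split; apply: eq_bigr => i _; rewrite mxE mulrDl. Qed.

Lemma dotpZl c u v : dotp (c *: u) v = c * dotp u v.
Proof. by rewrite mulr_sumr; apply: eq_bigr => i _; rewrite mxE mulrA. Qed.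

Lemma dotpNl u v : dotp (- u) v = - dotp u v.
Proof. by rewrite -scaleN1r dotpZl mulN1r. Qed.

Lemma dotpDr u v w : dotp w (u + v) = dotp w u + dotp w v.
Proof. by rewrite dotpC dotpDl !(dotpC w). Qed.

Lemma dotpZr c u v : dotp v (c *: u) = c * dotp v u.
Proof. by rewrite dotpC dotpZl dotpC. Qed.

Lemma dotpNr u v : dotp v (- u) = - dotp v u.
Proof. by rewrite dotpC dotpNl dotpC. Qed.

Definition dotpE := (dotpDl, dotpDr, dotpNl, dotpNr, dotpZl, dotpZr).

Lemma dotp_ge0 u : 0 <= dotp u u.
Proof. by apply: sumr_ge0 => i _; rewrite -expr2 sqr_ge0. Qed.

Lemma enorm_ge0 u : 0 <= enorm u.
Proof. exact: sqrtr_ge0. Qed.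

Lemma enorm_sqr u : enorm u ^+ 2 = dotp u u.
Proof. by rewrite sqr_sqrtr ?dotp_ge0. Qed.

Lemma enorm_sqrBZ c u g : enorm (u - c *: g) ^+ 2 =
  enorm u ^+ 2 - 2 * c * dotp g u + c ^+ 2 * enorm g ^+ 2.
Proof. rewrite !enorm_sqr !dotpE (dotpC u g); ring. Qed.

Lemma ler_enorm u v : (enorm u <= enorm v) = (dotp u u <= dotp v v).
Proof. by rewrite -!enorm_sqr ler_sqr ?nnegrE ?enorm_ge0. Qed.

Lemma enorm0 : enorm (0 : 'rV[R]_n) = 0.
Proof. by rewrite /enorm -(scale0r 0) dotpZl mul0r sqrtr0. Qed.

Lemma enormN u : enorm (- u) = enorm u.
Proof. by rewrite /enorm !dotpE opprK. Qed.

Lemma enormBC u v : enorm (u - v) = enorm (v - u).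
Proof. by rewrite -enormN opprB. Qed.

Lemma ler_coord_enorm u i : `|u 0 i| <= enorm u.
Proof.
rewrite -(@ler_pXn2r _ 2) ?nnegrE ?enorm_ge0 ?normr_ge0//.
rewrite enorm_sqr /dotp (bigD1 i)//= real_normK ?num_real// expr2 lerDl.
by apply: sumr_ge0 => k _; rewrite -expr2 sqr_ge0.
Qed.

Lemma ler_norm_enorm u : `|u| <= enorm u.
Proof.
rewrite {1}/Num.norm /=.
have [->|/mx_norm_neq0[[i j] /= ->]] := eqVneq (mx_norm u) 0.
  exact: enorm_ge0.
by rewrite (ord1 i) ler_coord_enorm.
Qed.

Lemma enorm_eq0 u : enorm u = 0 -> u = 0.
Proof. by move=> u0; apply/normr0_eq0/le_anti; rewrite normr_ge0 -{1}u0 ler_norm_enorm. Qed.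

(** For v nonzero, the squared norm of <v,v> u - <u,v> v equals <v,v> times <u,u> <v,v> - <u,v>^2;
    it is nonnegative and <v,v> > 0 can be cancelled. *)
Lemma CauchySchwarz_dotp u v : dotp u v <= enorm u * enorm v.
Proof.
have [v0|v0] := eqVneq (dotp v v) 0.
  have -> : v = 0 by apply: enorm_eq0; rewrite /enorm v0 sqrtr0.
  by rewrite enorm0 mulr0 -(scale0r 0) dotpZr mul0r.
have vp : 0 < dotp v v by rewrite lt_def v0 dotp_ge0.
have := dotp_ge0 (dotp v v *: u - dotp u v *: v).
rewrite !dotpE (dotpC v u) => h.
have {}h : 0 <= dotp v v * (dotp u u * dotp v v - dotp u v ^+ 2) by lra.
rewrite pmulr_rge0// subr_ge0 in h.
apply: le_trans (ler_norm _) _.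
rewrite -(@ler_pXn2r _ 2) ?nnegrE ?mulr_ge0 ?enorm_ge0//.
by rewrite real_normK ?num_real// exprMn !enorm_sqr.
Qed.

Lemma ler_enormD u v : enorm (u + v) <= enorm u + enorm v.
Proof.
rewrite -(@ler_pXn2r _ 2) ?nnegrE ?addr_ge0 ?enorm_ge0// enorm_sqr !dotpE.
have := CauchySchwarz_dotp u v; rewrite (dotpC v u) sqrrD !enorm_sqr; lra.
Qed.

Lemma continuous_coord (i : 'I_n) : continuous (fun u : 'rV[R]_n => u 0 i).
Proof. exact: coord_continuous. Qed.

Lemma continuous_enorm : continuous (enorm : 'rV[R]_n -> R).
Proof.
move=> u; apply: (@continuous_comp _ _ _ (fun v : 'rV[R]_n => dotp v v) (@Num.sqrt R));
  last exact: sqrt_continuous.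
apply: continuous_big => [|i _ v]; first exact: add_continuous.
have h := @continuous_coord i v; exact: (cvgM h h).
Qed.

Lemma continuous_enormB y : continuous (fun u => enorm (y - u)).
Proof.
move=> u; apply: (@continuous_comp _ _ _ (fun v : 'rV[R]_n => y - v) enorm).
  have := cvgB (cvg_cst y) (@cvg_id _ (nbhs u)); apply.
exact: continuous_enorm.
Qed.

Lemma compact_bound W (h : 'rV[R]_n -> R) : W !=set0 -> compact W ->
  continuous h -> exists K, forall v, W v -> `|h v| <= K.
Proof.
move=> W0 cW ch.
have [|c _ cmax] := EVT_max_rV W0 cW (f := fun v => `|h v|).
  apply: continuous_subspaceT => v; apply: continuous_comp; first exact: ch.
  exact: norm_continuous.
by exists `|h c| => v Wv; exact/cmax/mem_set.
Qed.

(** Compactness provides a nearest point, so the [get] inside [proj] does not fall back on its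
    default value. *)
Lemma projP W u : W !=set0 -> compact W ->
  W (proj W u) /\ forall v, W v -> enorm (u - proj W u) <= enorm (u - v).
Proof.
move=> W0 cW.
have [|c /set_mem cin cmin] := EVT_min_rV W0 cW (f := fun v => enorm (u - v)).
  by apply: continuous_subspaceT; exact: continuous_enormB.
suff : [set v | W v /\ forall v', W v' -> enorm (u - v) <= enorm (u - v')]
    (proj W u) by [].
apply: getPex; exists c; split => // v Wv; exact/cmin/mem_set.
Qed.

Lemma segment_convex W u v t : @convex_set R 'rV[R]_n W -> W u -> W v ->
  0 <= t <= 1 -> W (u + t *: (v - u)).
Proof.
move=> cW Wu Wv t01.
have := cW v u (Itv01 (andP t01).1 (andP t01).2) (mem_set Wv) (mem_set Wu).
move=> /set_mem; congr W; rewrite /conv /= /unstable.onem.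
by rewrite scalerBl scale1r scalerBr addrCA addrC -addrA.
Qed.

(** Moving from the projection p a fraction t towards v stays in W and changes the squared distance
    to u by t^2 N - 2 t s, where s is the inner product and N = |v - p|^2. If s were positive, a
    small t would beat the nearest point. *)
Lemma proj_obtuse W u v : @convex_set R 'rV[R]_n W -> W !=set0 -> compact W ->
  W v -> dotp (u - proj W u) (v - proj W u) <= 0.
Proof.
move=> convW W0 cW Wv; have [Wp minp] := projP u W0 cW.
set p := proj W u in Wp minp *.
set s := dotp _ _; rewrite leNgt; apply/negP => s0.
pose N := dotp (v - p) (v - p); have N0 : 0 <= N := dotp_ge0 _.
have sN : 0 < s + N by rewrite ltr_pwDl.
(* This t satisfies both t <= 1 and t N <= s, and its denominator is positive even when N = 0. *)
pose t := s / (s + N).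
have t0 : 0 < t by rewrite divr_gt0.
have t1 : t <= 1 by rewrite ler_pdivrMr// mul1r lerDl.
have tN : t * N <= s.
  by rewrite /t mulrAC ler_pdivrMr// ler_wpM2l ?(ltW s0)// lerDr ltW.
have := minp _ (segment_convex convW Wp Wv (introT andP (conj (ltW t0) t1))).
rewrite ler_enorm.
have -> : u - (p + t *: (v - p)) = (u - p) - t *: (v - p) by rewrite opprD addrA.
move: (u - p) (v - p) @s @N s0 N0 sN @t t0 t1 tN => x z s N s0 N0 sN t t0 t1 tN.
rewrite !dotpE (dotpC z x) -/s -/N => h.
have h2 : t * (2 * s - t * N) <= 0 by lra.
by rewrite pmulr_rle0// in h2; lra.
Qed.

(** With p and q the projections, the obtuse-angle inequalities at p and at q add up to |p - q|^2 <=
    <u - v, p - q>. Cauchy-Schwarz follows, then division by |p - q| unless p = q. *)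
Lemma proj_nonexpansive W u v : @convex_set R 'rV[R]_n W -> W !=set0 ->
  compact W -> enorm (proj W u - proj W v) <= enorm (u - v).
Proof.
move=> convW W0 cW; have [Wp _] := projP u W0 cW; have [Wq _] := projP v W0 cW.
have := proj_obtuse u convW W0 cW Wq; have := proj_obtuse v convW W0 cW Wp.
move: (proj W u) (proj W v) => p q hv hu.
have : enorm (p - q) ^+ 2 <= enorm (u - v) * enorm (p - q).
  apply: le_trans (CauchySchwarz_dotp (u - v) (p - q)).
  rewrite enorm_sqr; move: hu hv; rewrite !dotpE (dotpC q p); lra.
have [/enorm_eq0 ->|pq] := eqVneq (enorm (p - q)) 0.
  by rewrite enorm0 enorm_ge0.
by rewrite expr2 ler_pM2r// lt_def pq enorm_ge0.
Qed.

Lemma proj_id W u : W u -> W !=set0 -> compact W -> proj W u = u.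
Proof.
move=> Wu W0 cW; have [_ /(_ _ Wu)] := projP u W0 cW.
rewrite subrr enorm0 => h; apply/esym/eqP; rewrite -subr_eq0; apply/eqP.
by apply: enorm_eq0; apply/le_anti; rewrite h enorm_ge0.
Qed.

(** As [a] is its own projection, m <= |y - a| <= z + x, with m, x, z as named in the proof.
    Squaring m - x <= z gives m^2 <= z^2 + 2 m x - x^2, and m <= D does the rest. *)
Lemma proj_drift W y a b D : @convex_set R 'rV[R]_n W -> compact W -> W a ->
  enorm (proj W y - a) <= D ->
  enorm (proj W y - a) ^+ 2 <= enorm (y - b) ^+ 2 + 2 * D * enorm (b - a).
Proof.
move=> convW cW Wa; have W0 : W !=set0 by exists a.
have := proj_nonexpansive y a convW W0 cW; rewrite (proj_id Wa)//.
have := ler_enormD (y - b) (b - a); rewrite addrA subrK.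
have := enorm_ge0 (y - b); have := enorm_ge0 (b - a).
have := enorm_ge0 (proj W y - a).
set m := enorm (proj W y - a); set x := enorm (b - a); set z := enorm (y - b).
move=> m0 x0 z0 mz1 mz2 mD.
have mz : m - x <= z by lra.
have mDx : m * x <= D * x by rewrite ler_wpM2r.
(* Squaring requires m - x >= 0; in the other case m^2 <= m x <= D x directly. *)
have [mx|/ltW xm] := leP m x.
  have : m * m <= m * x by rewrite ler_wpM2l.
  have := sqr_ge0 z; have : 0 <= m * x by rewrite mulr_ge0.
  rewrite expr2; lra.
have : (m - x) ^+ 2 <= z ^+ 2 by rewrite ler_pXn2r ?nnegrE ?subr_ge0.
have := sqr_ge0 x; rewrite sqrrB; lra.
Qed.

(** Nonexpansiveness is Euclidean while the topology comes from the max norm; the max norm is the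
    smaller one, so the estimate transfers. Continuity is what makes a projected iterate
    measurable. *)
Lemma continuous_proj W : @convex_set R 'rV[R]_n W -> W !=set0 -> compact W ->
  continuous (proj W).
Proof.
move=> convW W0 cW u.
have h : enorm (u - v) @[v --> u] --> 0.
  by have := @continuous_enormB u u; rewrite /continuous_at subrr enorm0.
apply/(@cvgrPdist_lt _ _ _ _ (nbhs_filter u)) => eps eps0.
move/(@cvgrPdist_lt _ _ _ _ (nbhs_filter u)) : h => /(_ _ eps0).
apply: (@filterS _ _ (nbhs_filter u)) => v.
rewrite sub0r normrN ger0_norm ?enorm_ge0//; apply: le_lt_trans.
exact: le_trans (ler_norm_enorm _) (proj_nonexpansive _ _ convW W0 cW).
Qed.

Lemma le_diam W u v : compact W -> W u -> W v -> enorm (u - v) <= diam W.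
Proof.
move=> cW Wu Wv; apply: sup_upper_bound; last by exists u, v.
split; first by exists (enorm (u - v)); exists u, v.
have W0 : W !=set0 by exists u.
(* [sup] bounds the distances only if they are bounded above. Going through u, any two points of W
   are at most twice the largest distance to u apart. *)
have [|c /set_mem cin cmax] := EVT_max_rV W0 cW (f := fun v => enorm (u - v)).
  by apply: continuous_subspaceT; exact: continuous_enormB.
exists (enorm (u - c) + enorm (u - c)) => _ [x [y [Wx Wy ->]]].
rewrite -(subrK u x) -addrA; apply: le_trans (ler_enormD _ _) _.
by rewrite (enormBC x) lerD// cmax ?inE.
Qed.

End EuclideanGeometry.

(** * Borel measurability of random vectors *)

Section BorelVectors.
Context {R : realType} {n : nat}.
Let V := g_sigma_algebraType (@open 'rV[R]_n).

Lemma continuous_borel_measurable (h : 'rV[R]_n -> R) :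
  continuous h -> measurable_fun setT (h : V -> R).
Proof.
move=> /continuousP ch; apply: (measurability _ (RGenOpens.measurableE R)).
move=> _ [U [a [b ->] <-]]; rewrite setTI; apply: sub_sigma_algebra.
exact/ch/interval_open.
Qed.

Context {d : measure_display} {Omega : measurableType d}.
Implicit Types X Y : Omega -> 'rV[R]_n.

Lemma random_vectorP X : random_vector X <-> measurable_fun setT (X : Omega -> V).
Proof.
split=> [mX _ B mB|mX B mB]; first by rewrite setTI; exact: mX.
by rewrite -[X in measurable X]setTI; exact: mX.
Qed.

Lemma random_vector_open X :
  (forall U, open U -> measurable (X @^-1` U)) -> random_vector X.
Proof.
move=> mX; apply/random_vectorP; apply: (@measurability _ _ _ V _ _ open) => //.
by move=> _ [U oU <-]; rewrite setTI; exact: mX.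
Qed.

Lemma measurable_borel_random X (h : V -> R) :
  random_vector X -> measurable_fun setT h -> measurable_fun setT (h \o X).
Proof.
by move=> /random_vectorP mX mh; exact: (@measurableT_comp _ _ _ _ V).
Qed.

Lemma measurable_continuous_random X (h : 'rV[R]_n -> R) :
  random_vector X -> continuous h -> measurable_fun setT (h \o X).
Proof.
by move=> mX /continuous_borel_measurable; exact: measurable_borel_random.
Qed.

Lemma random_vector_continuous X (g : 'rV[R]_n -> 'rV[R]_n) :
  random_vector X -> continuous g -> random_vector (g \o X).
Proof.
move=> mX /continuousP cg; apply: random_vector_open => U oU.
by rewrite comp_preimage; apply: mX; apply: sub_sigma_algebra; exact: cg.
Qed.

Lemma random_vector_coord X i :
  random_vector X -> measurable_fun setT (fun x => X x 0 i).
Proof.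
by move=> mX; have := measurable_continuous_random mX (@continuous_coord R n i).
Qed.

Lemma random_vector_cst (v : 'rV[R]_n) : random_vector (fun _ : Omega => v).
Proof. by apply/random_vectorP; exact: measurable_cst. Qed.

(* An open set is the countable union of the balls with rational centre and
   radius 1/(k+1) that it contains. *)
Lemma random_vector_coords X :
  (forall i, measurable_fun setT (fun x => X x 0 i)) -> random_vector X.
Proof.
move=> mX; apply: random_vector_open => U oU.
pose c (q : 'rV[rat]_n) : 'rV[R]_n := map_mx ratr q.
pose r k : R := k.+1%:R^-1.
pose B (p : 'rV[rat]_n * nat) : set Omega :=
  if `[< ball (c p.1) (r p.2) `<=` U >]
  then [set x | ball (c p.1) (r p.2) (X x)] else set0.
have -> : X @^-1` U = \bigcup_p B p.
  apply/seteqP; split => [x /= Ux|x [p _]]; last first.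
    by rewrite /B; case: asboolP => // h /= /h.
  have /nbhs_ballP[eps /= eps0 epsU] := open_nbhs_nbhs (conj oU Ux).
  (* Then k + 1 > 2 / eps, that is 2 r k < eps: one r k separates the rational centre from X x, the
     other is the radius of the ball. *)
  pose k := Num.trunc (2 / eps).
  have r0 : 0 < r k by rewrite invr_gt0 ltr0n.
  have rk : 2 * r k < eps.
    by rewrite ltr_pdivrMr ?ltr0n// mulrC -ltr_pdivrMr// truncnS_gt.
  have qP i : exists q : rat, ratr q \in `](X x 0 i - r k), (X x 0 i + r k)[.
    by apply: rat_in_itvoo; lra.
  pose q : 'rV[rat]_n := \row_i sval (cid (qP i)).
  have qx i : `|c q 0 i - X x 0 i| < r k.
    rewrite !mxE; case: (cid _) => /= a; rewrite in_itv/= => ?.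
    by rewrite ltr_norml; lra.
  exists (q, k) => //; rewrite /B /= ifT; last first.
    apply/asboolP => v [_ cv]; apply: epsU; split => // i j.
    rewrite (ord1 i); have := qx j; have := cv 0 j; rewrite /ball/= => h1 h2.
    have -> : X x 0 j - v 0 j = (c q 0 j - v 0 j) - (c q 0 j - X x 0 j) by lra.
    by apply: le_lt_trans (ler_normB _ _) _; lra.
  by split => // i j; rewrite (ord1 i); exact: qx.
apply: countable_bigcupT_measurable => [|p]; first exact: countableP.
rewrite /B; case: asboolP => // _.
rewrite (_ : [set _ | _] = \bigcap_(i in [set: 'I_n])
    (fun x => X x 0 i) @^-1` ball (c p.1 0 i) (r p.2)).
  apply: fin_bigcap_measurable => // i _; rewrite -[X in measurable X]setTI.
  by apply: mX => //; exact: measurable_ball.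
apply/seteqP; split => [x [_ h] i _|x h] /=; first exact: h.
split; first by rewrite invr_gt0 ltr0n.
by move=> i j; rewrite (ord1 i); exact: h.
Qed.

End BorelVectors.

(** * Borel measurability of the gradient *)

Section Gradient.
Context {R : realType} {n : nat}.
Let V := g_sigma_algebraType (@open 'rV[R]_n).

(** The gradient of a differentiable function may be discontinuous, but each coordinate is the
    pointwise limit of the difference quotients with steps 1/(k+1), which are continuous. *)
Lemma measurable_grad (f : 'rV[R]_n -> R) (i : 'I_n) :
  (forall v, differentiable f v) ->
  measurable_fun setT (fun v : V => grad f v 0 i).
Proof.
move=> df; pose e : 'rV[R]_n := delta_mx 0 i.
pose D k (v : V) := (@harmonic R k)^-1 * (f (harmonic k *: e + v) - f v).
apply: (@measurable_fun_cvg _ _ _ _ D) => [k|v _].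
  apply: continuous_borel_measurable => v.
  have cf u : {for u, continuous f} by exact: differentiable_continuous.
  have cs : {for v, continuous (fun w => harmonic k *: e + w)}.
    have := cvgD (cvg_cst (harmonic k *: e)) (@cvg_id _ (nbhs v)); apply.
  have cfs := continuous_comp cs (cf _).
  have := cvgM (cvg_cst (@harmonic R k)^-1) (cvgB cfs (cf v)); apply.
rewrite mxE; have /cvgr_dnbhsP := @diff_derivable _ _ _ f v e (df v); apply.
by split => [k|]; [rewrite gt_eqF ?invr_gt0|exact: cvg_harmonic].
Qed.

End Gradient.

(** * Orthogonality of a conditionally centred variable to functions of X *)

Section CondMeanZero.
Import HBSimple HBNNSimple.
Context {R : realType} {d : measure_display} {Omega : measurableType d}.
Context {n : nat} (P : probability Omega R).
Variables (X : Omega -> 'rV[R]_n) (Z : Omega -> R).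
Hypotheses (mX : random_vector X) (iZ : P.-integrable setT (EFin \o Z)).
Hypothesis Z0 : forall A, sigma_rV X A -> (\int[P]_(x in A) (Z x)%:E = 0)%E.
Let V := g_sigma_algebraType (@open 'rV[R]_n).

(** A simple function of X is a finite combination of indicators of events in [sigma_rV X], and Z
    integrates to zero over each of them. *)
Let integral_nnsfun_mul0 (s : {nnsfun V >-> R}) :
  (\int[P]_x (s (X x) * Z x)%:E = 0)%E.
Proof.
pose A y := X @^-1` (s @^-1` [set y]).
have mB y : measurable (s @^-1` [set y] : set V) by exact: measurable_funPTI.
have mA y : measurable (A y) by apply: mX; exact: mB.
under eq_integral => x _.
  rewrite (fimfunE s) (fsbig_finite _ _ (fimfunP s)) mulr_suml -sumEFin.
  under eq_bigr => y _.
    rewrite (_ : (_ * _)%:E = (y%:E * ((EFin \o Z) \_ (A y)) x)%E); last first.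
      rewrite patchE indicE (_ : (x \in A y) = (X x \in s @^-1` [set y])); last first.
        by apply/idP/idP => /set_mem ?; apply/mem_set.
      by case: ifP => _ /=; rewrite ?mulr1 ?mulr0 ?mul0r ?mule0// EFinM.
    over.
  over.
have iA y : P.-integrable setT ((EFin \o Z) \_ (A y)).
  rewrite -integrable_mkcond//; exact: integrableS iZ.
rewrite integral_sum// => [|y]; last exact: integrableZl.
rewrite big1// => y _; rewrite integralZl// -integral_mkcond Z0 ?mule0//.
by exists (s @^-1` [set y]); [exact: mB|rewrite setTI].
Qed.


(** Simple functions increasing to h reduce this to the previous case, by dominated convergence with
    dominating function K |Z|. *)
Let integral_ge0_mul0 (h : V -> R) K : measurable_fun setT h ->
  (forall v, 0 <= h v) -> (forall x, h (X x) <= K) ->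
  (\int[P]_x (h (X x) * Z x)%:E = 0)%E.
Proof.
move=> mh h0 hK.
have mEh : measurable_fun setT (EFin \o h) by exact/measurable_EFinP.
have mZ : measurable_fun setT Z by apply/measurable_EFinP; case/integrableP : iZ.
pose s := nnsfun_approx measurableT mEh.
have hs v : EFin \o s^~ v @ \oo --> (h v)%:E.
  by apply: cvg_nnsfun_approx => // w _; rewrite lee_fin.
have sh k v : s k v <= h v.
  by rewrite -lee_fin nnsfun_approxE; apply: le_approx => // w _; rewrite lee_fin.
have mXV : measurable_fun setT (X : Omega -> V) by exact/random_vectorP.
have [|||||_ _] := @dominated_convergence _ Omega R P setT measurableT
  (fun k x => (s k (X x) * Z x)%:E) (fun x => (h (X x) * Z x)%:E)
  (fun x => (K%:E * (`|Z x|)%:E)%E).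
- move=> k; apply/measurable_EFinP/measurable_funM => //.
  exact: (measurableT_comp _ mXV).
- apply/measurable_EFinP/measurable_funM => //.
  exact: (measurableT_comp _ mXV).
- apply: aeW => x _; apply: cvg_EFin; first exact: nearW.
  by apply: cvgM; [exact: fine_cvg (hs _)|exact: cvg_cst].
- by apply: integrableZl => //; exact: integrable_norm.
- apply: aeW => x k _; rewrite -EFinM lee_fin normrM ler_wpM2r//.
  by rewrite ger0_norm ?fun_ge0//; exact: le_trans (sh _ _) (hK _).
rewrite (_ : (fun k => _) = cst 0%E); last first.
  by apply/funext => k /=; rewrite integral_nnsfun_mul0.
by move/cvg_lim => <- //; rewrite lim_cst.
Qed.

Lemma integrable_cond_mul (h : V -> R) K : measurable_fun setT h ->
  (forall x, `|h (X x)| <= K) ->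
  P.-integrable setT (fun x => (h (X x) * Z x)%:E).
Proof.
move=> mh hK; apply: (@integrableMr _ _ _ P setT measurableT (h \o X)) iZ.
  exact: measurable_borel_random.
by exists K; split; rewrite ?num_real// => M KM x _; apply: le_trans (hK x) (ltW KM).
Qed.

(** Positive and negative parts of h are treated separately. The bound K concerns h only at values
    of X, which suits gradients bounded on the feasible set alone. *)
Lemma Rintegral_cond_mul (h : V -> R) K : measurable_fun setT h ->
  (forall x, `|h (X x)| <= K) -> \int[P]_x (h (X x) * Z x) = 0.
Proof.
move=> mh hK.
pose hp v := Num.max (h v) 0; pose hn v := Num.max (- h v) 0.
have mhp : measurable_fun setT hp by apply: measurable_maxr.
have mhn : measurable_fun setT hn.
  by apply: measurable_maxr => //; exact: measurableT_comp.
have K0 x : 0 <= K := le_trans (normr_ge0 _) (hK x).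
have hpK x : hp (X x) <= K.
  by rewrite ge_max K0// andbT (le_trans (ler_norm _)).
have hnK x : hn (X x) <= K.
  by rewrite ge_max K0// andbT (le_trans (ler_norm _))// normrN.
have hp0 v : 0 <= hp v by rewrite le_max lexx orbT.
have hn0 v : 0 <= hn v by rewrite le_max lexx orbT.
have hpn v : h v = hp v - hn v.
  rewrite /hp /hn; case/orP: (le_total 0 (h v)) => h0.
    by rewrite max_l// max_r ?subr0// oppr_le0.
  by rewrite max_r// max_l ?opprK ?add0r// oppr_ge0.
under eq_Rintegral => x _ do rewrite hpn mulrBl.
rewrite RintegralB//.
- by rewrite /Rintegral !(@integral_ge0_mul0 _ K)// subrr.
- by apply: (@integrable_cond_mul _ K) => // x; rewrite ger0_norm.
- by apply: (@integrable_cond_mul _ K) => // x; rewrite ger0_norm.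
Qed.

End CondMeanZero.

(** * Expectations as real-valued integrals *)

Section Expectation.
Context {R : realType} {d : measure_display} {Omega : measurableType d}.
Variable P : probability Omega R.
Implicit Types Y Z : Omega -> R.

Lemma integrable_random_cst (c : R) : P.-integrable setT (EFin \o cst c).
Proof. by apply: finite_measure_integrable_cst. Qed.

Lemma Rintegral_probability_cst (c : R) : \int[P]_x c = c.
Proof. by rewrite Rintegral_cst//= probability_setT mulr1. Qed.

Lemma Rexpectation Y : P.-integrable setT (EFin \o Y) ->
  'E_P[Y]%E = (\int[P]_x Y x)%:E.
Proof. by move=> iY; rewrite unlock fineK// integrable_fin_num. Qed.

(** For a nonnegative variable, a finite bound on the extended-real expectation already forces
    integrability. It serves for the second moment of the gradient error. *)
Lemma Rintegral_le_cst Y (c : R) : measurable_fun setT Y ->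
  (forall x, 0 <= Y x) -> ('E_P[Y] <= c%:E)%E ->
  P.-integrable setT (EFin \o Y) /\ \int[P]_x Y x <= c.
Proof.
move=> mY Y0 Yc.
have iY : P.-integrable setT (EFin \o Y).
  apply/integrableP; split; first exact/measurable_EFinP.
  under eq_integral => x _ do rewrite /= ger0_norm//.
  by apply: le_lt_trans (ltry c); move: Yc; rewrite unlock.
by split => //; rewrite -lee_fin -Rexpectation.
Qed.

Context {n : nat}.
Let V := g_sigma_algebraType (@open 'rV[R]_n).
Implicit Types X : Omega -> 'rV[R]_n.

Lemma integrable_continuous_random X W (h : 'rV[R]_n -> R) :
  random_vector X -> (forall x, W (X x)) -> W !=set0 -> compact W ->
  continuous h -> P.-integrable setT (EFin \o (h \o X)).
Proof.
move=> mX WX W0 cW ch; have [K hK] := compact_bound W0 cW ch.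
apply: measurable_bounded_integrable => //.
- by rewrite /= probability_setT ltry.
- exact: measurable_continuous_random.
exists K; split; rewrite ?num_real// => M KM x _.
by apply: le_trans (ltW KM); exact: hK.
Qed.

Lemma measurable_sqr_enorm X : random_vector X ->
  measurable_fun setT (fun x => enorm (X x) ^+ 2).
Proof.
move=> mX; apply: (measurable_continuous_random (h := fun u => enorm u ^+ 2)) => //.
move=> u; apply: (@continuous_comp _ _ _ enorm (fun r => r ^+ 2)).
  exact: continuous_enorm.
exact: exprn_continuous.
Qed.

End Expectation.

(** * One projected gradient step in expectation *)

Section Descent.
Context {R : realType} {d : measure_display} {Omega : measurableType d}.
Context {n : nat} (P : probability Omega R).
Variables (f : 'rV[R]_n -> R) (W : set 'rV[R]_n) (b : 'rV[R]_n).
Variables (alpha kappa C G : R).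
Hypotheses (df : forall v, differentiable f v) (Wb : W b) (cW : compact W).
Hypothesis grad_bound : forall v, W v -> enorm (grad f v) <= G.
Hypothesis descent : forall v, W v ->
  - 2 * alpha * dotp (grad f v) (v - b) + alpha ^+ 2 * enorm (grad f v) ^+ 2 <=
  - kappa * (f v - f b) + C.
Variable X : Omega -> 'rV[R]_n.
Hypotheses (mX : random_vector X) (WX : forall x, W (X x)).
Let V := g_sigma_algebraType (@open 'rV[R]_n).
Let W0 : W !=set0. Proof. by exists b. Qed.

Let cf : continuous f.
Proof. by move=> v; exact: differentiable_continuous. Qed.

Let csqr (a : 'rV[R]_n) : continuous (fun v : 'rV[R]_n => enorm (v - a) ^+ 2).
Proof.
rewrite (_ : (fun _ => _) = fun v : 'rV[R]_n => enorm (a - v) ^+ 2); last first.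
  by apply/funext => v; rewrite enormBC.
move=> u; apply: (@continuous_comp _ _ _ (fun v : 'rV[R]_n => enorm (a - v)) (fun r => r ^+ 2)).
  exact: continuous_enormB.
exact: exprn_continuous.
Qed.

Lemma integrable_value : P.-integrable setT (EFin \o (f \o X)).
Proof. exact: (integrable_continuous_random _ mX WX). Qed.

Lemma integrable_sqr_dist :
  P.-integrable setT (EFin \o (fun x => enorm (X x - b) ^+ 2)).
Proof. exact: (integrable_continuous_random P mX WX W0 cW (@csqr b)). Qed.

Lemma last_gap :
  kappa * (\int[P]_x f (X x) - f b) <= \int[P]_x enorm (X x - b) ^+ 2 + C.
Proof.
have iD := integrable_sqr_dist; have iF := integrable_value.
have ic := integrable_random_cst P.
have : \int[P]_x (kappa * f (X x)) <=
    \int[P]_x (enorm (X x - b) ^+ 2 + (C + kappa * f b)).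
  apply: le_Rintegral => //.
  - exact: (integrableZl _ kappa iF).
  - exact: (integrableD _ iD (ic _)).
  move=> x _; have := descent (WX x).
  have := sqr_ge0 (enorm (X x - b - alpha *: grad f (X x))).
  by rewrite enorm_sqrBZ; lra.
rewrite RintegralZl// RintegralD// ?Rintegral_probability_cst; last exact: ic.
lra.
Qed.

Lemma pgd_step (e : Omega -> 'rV[R]_n) (delta D : R) (W' : set 'rV[R]_n)
    (a : 'rV[R]_n) (Y : Omega -> 'rV[R]_n) :
  random_vector e -> cond_mean_zero P e X ->
  ('E_P[fun x => (enorm (e x) ^+ 2)%R] <= (delta ^+ 2)%:E)%E ->
  @convex_set R 'rV[R]_n W' -> compact W' -> W' a ->
  (forall u v, W' u -> W' v -> enorm (u - v) <= D) ->
  (forall x, Y x = proj W' (X x - alpha *: (grad f (X x) + e x))) ->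
  [/\ random_vector Y, forall x, W' (Y x) &
    \int[P]_x enorm (Y x - a) ^+ 2 + kappa * (\int[P]_x f (X x) - f b) <=
    \int[P]_x enorm (X x - b) ^+ 2 + C + alpha ^+ 2 * delta ^+ 2
      + 2 * D * enorm (b - a)].
Proof.
move=> me cme e2 convW' cW' W'a diamW' YE.
have W'0 : W' !=set0 by exists a.
have WY x : W' (Y x) by rewrite YE; exact: (projP _ W'0 cW').1.
have mY : random_vector Y.
  rewrite (_ : Y = proj W' \o (fun x => X x - alpha *: (grad f (X x) + e x))).
    (* The projection is continuous, but the gradient is only Borel, so its argument is handled
       coordinate by coordinate. *)
    apply: random_vector_continuous; last exact: continuous_proj.
    apply: random_vector_coords => i.
    rewrite (_ : (fun _ => _) =
      fun x => X x 0 i - alpha * (grad f (X x) 0 i + e x 0 i)); last first.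
      by apply/funext => x; rewrite !mxE.
    apply: measurable_funB; first exact: random_vector_coord.
    apply: measurable_funM; first exact: measurable_cst.
    apply: measurable_funD; last exact: random_vector_coord.
    exact: (measurable_borel_random mX (measurable_grad i df)).
  by apply/funext => x; rewrite YE.
split => //.
have ic := integrable_random_cst P.
have [ie ele] := Rintegral_le_cst (measurable_sqr_enorm me)
  (fun x => sqr_ge0 (enorm (e x))) e2.
have iYa := integrable_continuous_random P mY WY W'0 cW' (@csqr a).
have iD := integrable_sqr_dist; have iF := integrable_value.
(* The coefficient of the i-th error coordinate when the square |X - b - alpha (grad f + e)|^2 is
   expanded. *)
pose h i (v : V) : R := - 2 * alpha * (v - b) 0 i + 2 * alpha ^+ 2 * grad f v 0 i.
have mh i : measurable_fun setT (h i).
  apply: measurable_funD; apply: measurable_funM; try exact: measurable_cst.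
    under eq_fun do rewrite !mxE.
    apply: measurable_funB; last exact: measurable_cst.
    exact: (continuous_borel_measurable (@continuous_coord R n i)).
  exact: measurable_grad.
have [K hK] : exists K, forall i x, `|h i (X x)| <= K.
  have [K1 hK1] := compact_bound W0 cW (@csqr b).
  (* K1 bounds the squared distance to b, so r <= 1 + r^2 bounds the distance itself by 1 + K1. *)
  exists (`|- 2 * alpha| * (1 + K1) + `|2 * alpha ^+ 2| * G) => i x.
  apply: le_trans (ler_normD _ _) _; rewrite (normrM (- 2 * alpha)) (normrM (2 * alpha ^+ 2)).
  apply: lerD.
    apply: ler_wpM2l => //; apply: le_trans (ler_coord_enorm _ _) _.
    have := hK1 _ (WX x); rewrite ger0_norm ?sqr_ge0//.
    have := enorm_ge0 (X x - b); nra.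
  apply: ler_wpM2l => //; apply: le_trans (ler_coord_enorm _ _) _.
  exact/grad_bound/WX.
have ihe i : P.-integrable setT (fun x => (h i (X x) * e x 0 i)%:E).
  by have [ie' _ _ _] := cme i; apply: (integrable_cond_mul mX ie' (mh i) (hK i)).
have he0 i : \int[P]_x (h i (X x) * e x 0 i) = 0.
  have [ie' _ _ cme0] := cme i.
  apply: (Rintegral_cond_mul mX ie' _ (mh i) (hK i)) => A XA.
  by rewrite -cme0//; under eq_integral do rewrite /cst; rewrite integral0.
pose Z x := \sum_i h i (X x) * e x 0 i.
have iZ : P.-integrable setT (EFin \o Z).
  rewrite (_ : _ \o _ = fun x => (\sum_i (h i (X x) * e x 0 i)%:E)%E).
    exact: integrable_sum.
  by apply/funext => x; rewrite /= sumEFin.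
have Z0 : \int[P]_x Z x = 0.
  rewrite /Rintegral /Z; under eq_integral do rewrite -sumEFin.
  rewrite integral_sum// big1// => i _.
  rewrite -[LHS]fineK; last exact: integrable_fin_num.
  by congr (_%:E); exact: he0.
have ZE x : Z x = - 2 * alpha * dotp (e x) (X x - b)
                  + 2 * alpha ^+ 2 * dotp (e x) (grad f (X x)).
  rewrite /Z /dotp !mulr_sumr -big_split; apply: eq_bigr => i _ /=.
  by rewrite /h; ring.
have iE := integrableZl measurableT (alpha ^+ 2) ie.
have iDZ := integrableD measurableT iD iZ.
have iDZE := integrableD measurableT iDZ iE.
(* The inequality is proved pointwise, with the terms linear in e collected in Z; only after
   integration does Z disappear. *)
have : \int[P]_x (enorm (Y x - a) ^+ 2 + kappa * f (X x)) <=
    \int[P]_x (enorm (X x - b) ^+ 2 + Z x + alpha ^+ 2 * enorm (e x) ^+ 2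
      + (C + kappa * f b + 2 * D * enorm (b - a))).
  apply: le_Rintegral => //.
  - exact: (integrableD _ iYa (integrableZl _ kappa iF)).
  - exact: (integrableD _ iDZE (ic _)).
  move=> x _; have gd := descent (WX x).
  have Dx : enorm (Y x - a) <= D by exact: diamW'.
  move: Dx; rewrite YE => /(proj_drift b convW' cW' W'a).
  have -> : X x - alpha *: (grad f (X x) + e x) - b =
      (X x - b) - alpha *: (grad f (X x) + e x) by rewrite addrAC.
  rewrite enorm_sqrBZ dotpDl ZE.
  have -> : enorm (grad f (X x) + e x) ^+ 2 = enorm (grad f (X x)) ^+ 2
      + 2 * dotp (e x) (grad f (X x)) + enorm (e x) ^+ 2.
    by rewrite !enorm_sqr !dotpE (dotpC (grad f (X x)) (e x)); ring.
  lra.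
rewrite RintegralD//; last exact: (integrableZl _ kappa iF).
rewrite RintegralZl// RintegralD//; last exact: ic.
rewrite Rintegral_probability_cst.
rewrite RintegralD// RintegralD// RintegralZl// Z0.
have : alpha ^+ 2 * \int[P]_x (enorm (e x) ^+ 2) <= alpha ^+ 2 * delta ^+ 2.
  by rewrite ler_wpM2l ?sqr_ge0.
lra.
Qed.

End Descent.

(** * Summation over time and the two step-size regimes *)

Lemma ler_telescope {R : realDomainType} (S g c : nat -> R) (T : nat) :
  (1 <= T)%N ->
  (forall t, (1 <= t < T)%N -> S t.+1 + g t <= S t + c t) ->
  S T + \sum_(1 <= t < T) g t <= S 1%N + \sum_(1 <= t < T) c t.
Proof.
case: T => // T _; elim: T => [|T IH] step; first by rewrite !big_geq.
rewrite (big_nat_recr _ _ g)// (big_nat_recr _ _ c)//=.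
have := step T.+1 (ltnSn _).
have : S T.+1 + \sum_(1 <= t < T.+1) g t <= S 1%N + \sum_(1 <= t < T.+1) c t.
  by apply: IH => t /andP[t1 tT]; rewrite step// t1 ltnW.
lra.
Qed.

Lemma regret_bound (R : realType) (d : measure_display)
  (Omega : measurableType d) (P : probability Omega R) (n T : nat)
  (f : nat -> 'rV[R]_n -> R) (W : nat -> set 'rV[R]_n)
  (wstar : nat -> 'rV[R]_n) (D alpha kappa C : R) (alpha_ delta : nat -> R)
  (w1 : 'rV[R]_n) (e w : nat -> Omega -> 'rV[R]_n) :
  (1 <= T)%N ->
  (forall t, (1 <= t <= T)%N -> forall v, differentiable (f t) v) ->
  (forall t, (1 <= t <= T)%N -> W t (wstar t)) ->
  (forall t, (1 <= t <= T)%N -> compact (W t)) ->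
  (forall t, (1 <= t <= T)%N -> @convex_set R 'rV[R]_n (W t)) ->
  (forall t, (1 <= t <= T)%N ->
    forall u v, W t u -> W t v -> enorm (u - v) <= D) ->
  W 1%N w1 ->
  online_pgd T f W alpha_ e w1 w ->
  gradient_error T P delta w e ->
  (forall t, (1 <= t < T)%N -> alpha_ t = alpha) ->
  0 < kappa ->
  (forall t, (1 <= t <= T)%N ->
    exists G, forall v, W t v -> enorm (grad (f t) v) <= G) ->
  (forall t, (1 <= t <= T)%N -> forall v, W t v ->
    - 2 * alpha * dotp (grad (f t) v) (v - wstar t)
      + alpha ^+ 2 * enorm (grad (f t) v) ^+ 2 <=
    - kappa * (f t v - f t (wstar t)) + C) ->
  (regret T P f w wstar <=
    (kappa^-1 * (enorm (w1 - wstar 1%N) ^+ 2 + T%:R * C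
      + alpha ^+ 2 * (\sum_(1 <= t < T) delta t ^+ 2)
      + 2 * D * \sum_(1 <= t < T) enorm (wstar t - wstar t.+1)))%:E)%E.
Proof.
move=> T1 df Wwstar cW convW diamW Ww1 [w1E wE] err alphaE kappa0 gradG descent.
have lt_le t : (1 <= t < T)%N -> (1 <= t <= T)%N.
  by move=> /andP[-> /ltnW].
have lt_leS t : (1 <= t < T)%N -> (1 <= t.+1 <= T)%N by move=> /andP[].
pose S t := \int[P]_x enorm (w t x - wstar t) ^+ 2.
pose F t := \int[P]_x f t (w t x).
have step t : (1 <= t < T)%N -> random_vector (w t) -> (forall x, W t (w t x)) ->
  [/\ random_vector (w t.+1), forall x, W t.+1 (w t.+1 x) &
    S t.+1 + kappa * (F t - f t (wstar t)) <= S t + C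
      + alpha ^+ 2 * delta t ^+ 2 + 2 * D * enorm (wstar t - wstar t.+1)].
  move=> tT mw Ww; have [_ me cme e2] := err t tT.
  have tT' := lt_le t tT; have tTS := lt_leS t tT.
  have [G hG] := gradG t tT'.
  apply: (pgd_step (df _ tT') (Wwstar _ tT') (cW _ tT') hG (descent _ tT')
    mw Ww me cme e2 (convW _ tTS) (cW _ tTS) (Wwstar _ tTS) (diamW _ tTS)).
  by move=> x; rewrite wE// alphaE.
(* The step estimate presupposes a measurable, feasible iterate and returns the same for the next
   one. The induction starts at t = 1 with the constant w1; t = 0 is outside the range. *)
have rw t : (1 <= t <= T)%N -> random_vector (w t) /\ forall x, W t (w t x).
  elim: t => // -[_ _|t IH tT].
    split=> [|x]; last by rewrite w1E.
    by rewrite (_ : w 1%N = fun=> w1) ?funeqE//; exact: random_vector_cst.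
  have tT' : (1 <= t.+1 < T)%N by [].
  by have [mw Ww] := IH (lt_le _ tT'); have [] := step _ tT' mw Ww.
(* The regret is an extended real; it is finite because each f_t is continuous and w_t stays in a
   compact set. *)
have -> : regret T P f w wstar = (\sum_(1 <= t < T.+1) (F t - f t (wstar t)))%:E.
  rewrite /regret -sumEFin; apply: eq_big_nat => t tT.
  have [mw Ww] := rw t tT.
  by rewrite Rexpectation//; exact: (integrable_value P (df _ tT) (Wwstar _ tT) (cW _ tT)).
rewrite lee_fin ler_pdivlMl// big_nat_recr//=.
have TT : (1 <= T <= T)%N by rewrite T1 leqnn.
have [mwT WwT] := rw T TT.
have last_step := last_gap P (df _ TT) (Wwstar _ TT) (cW _ TT) (descent _ TT) mwT WwT.
have tele : S T + kappa * (\sum_(1 <= t < T) (F t - f t (wstar t))) <= S 1%N +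
    (\sum_(1 <= t < T) C + alpha ^+ 2 * (\sum_(1 <= t < T) delta t ^+ 2)
      + 2 * D * \sum_(1 <= t < T) enorm (wstar t - wstar t.+1)).
  rewrite !mulr_sumr -!big_split; apply: ler_telescope => // t tT.
  have [mw Ww] := rw t (lt_le t tT).
  by have [_ _] := step t tT mw Ww; rewrite /= !addrA.
have S1 : S 1%N = enorm (w1 - wstar 1%N) ^+ 2.
  by rewrite /S; under eq_Rintegral do rewrite w1E; rewrite Rintegral_probability_cst.
(* T - 1 copies of C come from the steps and one from the final round. *)
have TC : \sum_(1 <= t < T) C + C = T%:R * C.
  by rewrite sumr_const_nat -mulrSr subn1 prednK// mulr_natl.
move: tele last_step; rewrite S1 -TC -/(S T) -/(F T); lra.
Qed.

(* In (ii) the gradient term is c M^2 / (2 rho): with c M / (2 rho) the bound is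
   false, e.g. for T = n = rho = 1, f = 8 x^2 on [-1, 1], w1 = 1, M = 16,
   c = 1/4, where the regret is 8 and the bound would be 4. *)
Theorem theorem1 (R : realType) (d : measure_display)
  (Omega : measurableType d) (P : probability Omega R) (n T : nat)
  (f : nat -> 'rV[R]_n -> R) (W : nat -> set 'rV[R]_n)
  (wstar : nat -> 'rV[R]_n) (rho D : R) (alpha_ delta : nat -> R)
  (w1 : 'rV[R]_n) (e w : nat -> Omega -> 'rV[R]_n)
  (hT : (1 <= T)%N)
  (hrho : 0 < rho <= 1)
  (hdiff : forall t, (1 <= t <= T)%N -> forall v, differentiable (f t) v)
  (hmin : forall t, (1 <= t <= T)%N -> argmin (f t) (wstar t))
  (hclosed : forall t, (1 <= t <= T)%N -> closed (W t))
  (hconvex : forall t, (1 <= t <= T)%N -> @convex_set R 'rV[R]_n (W t))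
  (hargmin : forall t, (1 <= t <= T)%N -> argmin (f t) `<=` W t)
  (hquasar : forall t, (1 <= t <= T)%N -> quasar_convex rho (f t) (wstar t))
  (hbounded : forall t, (1 <= t <= T)%N -> bounded_set (W t))
  (hdiam : forall t, (1 <= t <= T)%N -> diam (W t) <= D)
  (hw1 : W 1%N w1)
  (hw : online_pgd T f W alpha_ e w1 w)
  (he : gradient_error T P delta w e) :
  let path := \sum_(1 <= t < T) enorm (wstar t - wstar t.+1) in
  let noise := \sum_(1 <= t < T) delta t ^+ 2 in
  let d1 := enorm (w1 - wstar 1%N) ^+ 2 in
  (forall Gamma alpha : R,
      (forall t, (1 <= t <= T)%N -> weakly_smooth Gamma (f t) (wstar t)) ->
      0 < alpha < 2 * rho / Gamma ->
      (forall t, (1 <= t < T)%N -> alpha_ t = alpha) ->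
      (regret T P f w wstar <=
        ((2 * alpha * rho - alpha ^+ 2 * Gamma)^-1 * d1
         + 3 * D / (2 * alpha * rho - alpha ^+ 2 * Gamma) * path
         + alpha / (2 * rho - alpha * Gamma) * noise)%:E)%E)
  /\
  (forall M c alpha : R,
      (forall t, (1 <= t <= T)%N ->
         forall v, W t v -> enorm (grad (f t) v) <= M) ->
      0 < c ->
      alpha = c / Num.sqrt T%:R ->
      (forall t, (1 <= t < T)%N -> alpha_ t = alpha) ->
      (regret T P f w wstar <=
        (((2 * c * rho)^-1 * d1 + c * M ^+ 2 / (2 * rho)) * Num.sqrt T%:R
         + 3 * D / (2 * rho * c) * Num.sqrt T%:R * path
         + alpha / (2 * rho) * noise)%:E)%E).
Proof.
move=> path noise d1; have /andP[rho0 _] := hrho.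
have Wwstar t (tT : (1 <= t <= T)%N) : W t (wstar t) by exact/hargmin/hmin.
have cW t (tT : (1 <= t <= T)%N) : compact (W t).
  exact: bounded_closed_compact (hbounded _ tT) (hclosed _ tT).
have diamW t (tT : (1 <= t <= T)%N) u v : W t u -> W t v -> enorm (u - v) <= D.
  by move=> Wu Wv; apply: le_trans (hdiam _ tT); apply: le_diam => //; exact: cW.
(* Nonnegativity of D times the path length is what relaxes the constant 2 D obtained from
   [regret_bound] to the stated 3 D. *)
have D0 : 0 <= D.
  by have := diamW 1%N hT _ _ hw1 hw1; rewrite subrr enorm0.
have path0 : 0 <= path by apply: sumr_ge0 => t _; exact: enorm_ge0.
have Dpath0 : 0 <= D * path by rewrite mulr_ge0.
have quasar t (tT : (1 <= t <= T)%N) v :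
    rho * (f t v - f t (wstar t)) <= dotp (grad (f t) v) (v - wstar t).
  have := hquasar _ tT v; rewrite -(opprB v) dotpNr => h.
  by rewrite -ler_pdivlMl//; lra.
have bound := regret_bound hT hdiff Wwstar cW hconvex diamW hw1 hw he.
split=> [Gamma alpha hsmooth /andP[alpha0 alphalt] alphaE|
         M c alpha hM c0 alphadef alphaE].
  (* The step-size range is nonempty, whereas 2 rho / Gamma <= 0 whenever Gamma <= 0 (division by
     zero yields 0). *)
  have Gamma0 : 0 < Gamma.
    rewrite ltNge; apply/negP => Gamma0; move: (lt_trans alpha0 alphalt).
    by apply/negP; rewrite -leNgt mulr_ge0_le0 ?invr_le0// mulr_ge0// ltW.
  have gap0 : 0 < 2 * rho - alpha * Gamma by rewrite subr_gt0 -ltr_pdivlMr.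
  have kappaE : 2 * alpha * rho - alpha ^+ 2 * Gamma =
    alpha * (2 * rho - alpha * Gamma) by ring.
  have kappa0 : 0 < 2 * alpha * rho - alpha ^+ 2 * Gamma.
    by rewrite kappaE mulr_gt0.
  apply: le_trans (bound alpha _ 0 alphaE kappa0 _ _) _.
  - move=> t tT.
    have cf : continuous (f t) by move=> v; exact/differentiable_continuous/hdiff.
    have W0 : W t !=set0 by exists (wstar t); exact: Wwstar.
    have [K hK] := compact_bound W0 (cW t tT) cf.
    (* Weak smoothness bounds the squared gradient norm by Gamma (K - f_t(wstar_t)); again r <= 1 +
       r^2. *)
    exists (1 + Gamma * (K - f t (wstar t))) => v Wv.
    have := hsmooth t tT v; have := hK v Wv; have := ler_norm (f t v).
    have := enorm_ge0 (grad (f t) v).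
    move=> g0 fn fK gK; have {fn fK} fK : f t v <= K by lra.
    have : Gamma * (f t v - f t (wstar t)) <= Gamma * (K - f t (wstar t)).
      by rewrite ler_wpM2l ?(ltW Gamma0)// lerD2r.
    nra.
  - move=> t tT v Wv.
    have : 2 * alpha * (rho * (f t v - f t (wstar t))) <=
           2 * alpha * dotp (grad (f t) v) (v - wstar t).
      by rewrite ler_wpM2l ?quasar// mulr_ge0// ltW.
    have : alpha ^+ 2 * enorm (grad (f t) v) ^+ 2 <=
           alpha ^+ 2 * (Gamma * (f t v - f t (wstar t))).
      by rewrite ler_wpM2l ?sqr_ge0// hsmooth.
    lra.
  rewrite lee_fin mulr0 addr0 -/d1 -/path -/noise kappaE.
  have -> : alpha / (2 * rho - alpha * Gamma) * noise =
      (alpha * (2 * rho - alpha * Gamma))^-1 * (alpha ^+ 2 * noise).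
    by field; rewrite !gt_eqF.
  have : 0 <= (alpha * (2 * rho - alpha * Gamma))^-1 * (D * path).
    by rewrite mulr_ge0// invr_ge0 mulr_ge0 ?ltW.
  move: (_^-1) => k; lra.
have sT : 0 < Num.sqrt (T%:R : R) by rewrite sqrtr_gt0 ltr0n.
have alpha0 : 0 < alpha by rewrite alphadef divr_gt0.
have kappa0 : 0 < 2 * alpha * rho by rewrite !mulr_gt0.
apply: le_trans (bound alpha _ (alpha ^+ 2 * M ^+ 2) alphaE kappa0 _ _) _.
- by move=> t tT; exists M => v; exact: hM.
- move=> t tT v Wv.
  have : 2 * alpha * (rho * (f t v - f t (wstar t))) <=
         2 * alpha * dotp (grad (f t) v) (v - wstar t).
    by rewrite ler_wpM2l ?quasar// mulr_ge0// ltW.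
  have : alpha ^+ 2 * enorm (grad (f t) v) ^+ 2 <= alpha ^+ 2 * M ^+ 2.
    have gM := hM t tT v Wv; have g0 := enorm_ge0 (grad (f t) v).
    by rewrite ler_wpM2l ?sqr_ge0// ler_pXn2r ?nnegrE// (le_trans g0).
  lra.
rewrite lee_fin -/d1 -/path -/noise.
(* With s = sqrt T and alpha = c / s, the total T alpha^2 M^2 is c^2 M^2, and dividing by 2 alpha
   rho leaves c M^2 s / (2 rho). *)
have TE : T%:R = Num.sqrt (T%:R : R) ^+ 2 by rewrite sqr_sqrtr ?ler0n.
rewrite [X in X * (alpha ^+ 2 * _)]TE alphadef.
move: (Num.sqrt (T%:R : R)) sT => s s0.
have -> : (2 * (c / s) * rho)^-1 * (d1 + s ^+ 2 * ((c / s) ^+ 2 * M ^+ 2)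
    + (c / s) ^+ 2 * noise + 2 * D * path) =
  ((2 * c * rho)^-1 * d1 + c * M ^+ 2 / (2 * rho)) * s
    + 2 * (s / (2 * rho * c) * (D * path)) + c / s / (2 * rho) * noise.
  by field; rewrite !gt_eqF.
have -> : 3 * D / (2 * rho * c) * s * path =
  3 * (s / (2 * rho * c) * (D * path)) by field; rewrite !gt_eqF.
have : 0 <= s / (2 * rho * c) * (D * path).
  by rewrite mulr_ge0// divr_ge0// ?mulr_ge0// ltW.
lra.
Qed.
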